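(* There are infinitely many number fields $L$ with $[L:\mathbb{Q}]=6$ and $\delta_L=1$.
   Context: For a number field $L$, let $N(L)$ be its Galois closure over $\mathbb{Q}$ and $X_L$ the transitive $\mathrm{Gal}(N(L)/\mathbb{Q})$-set of roots of the minimal polynomial of a primitive element of $L$. $\delta_L=\#\{g\in\mathrm{Gal}(N(L)/\mathbb{Q}): g\text{ has a cycle of odd length on }X_L\}/\#\mathrm{Gal}(N(L)/\mathbb{Q})$. *)

(* Defs.v *)
From HB Require Import structures.
From mathcomp Require Import all_boot all_order all_fingroup all_algebra.
From mathcomp Require Import all_solvable all_field.

Set Implicit Arguments.
Unset Strict Implicit.
Unset Printing Implicit Defensive.

Import GRing.Theory Num.Theory.
Local Open Scope ring_scope.

(* A number field is a fieldExtType rat: a finite-dimensional field extension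
   of rat, with degree \dim {:L}. Every ring morphism between number fields is
   rat-linear, so ring isomorphisms suffice here. *)
Definition field_isomorphic (K L : fieldExtType rat) : Prop :=
  exists f : {rmorphism K -> L}, bijective f.

Definition is_galois_closure (L : fieldExtType rat) (M : splittingFieldType rat)
    (iota : 'AHom(L, M)) : Prop :=
  galois 1 {:M} /\
  forall E : {subfield M},
    (limg iota <= E)%VS -> galois 1 E -> (E : {vspace M}) = {:M}%VS.

Definition primitive_elt (L : fieldExtType rat) : L :=
  separable_generator 1 {:L}.

Lemma separable_rat (L : fieldExtType rat) (U V : {subfield L}) : separable U V.
Proof.
apply/separableP=> y _; apply: pcharf0_separable => p.
by rewrite pchar_lalg pchar_num.
Qed.

Lemma primitive_eltP (L : fieldExtType rat) :
  <<1; primitive_elt L>>%VS = {:L}%VS.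
Proof.
by rewrite -eq_adjoin_separable_generator ?sub1v ?separable_rat.
Qed.

Lemma galois_rat (M : splittingFieldType rat) : galois 1 {:M}.
Proof. by rewrite /galois sub1v separable_rat normalFieldf. Qed.

Lemma fieldExt_horner_root (L : fieldExtType rat) (a : L) (q : {poly rat}) :
  (fieldExt_horner a q == 0) = root (map_poly (in_alg L) q) a.
Proof. by []. Qed.

Lemma galois_closure_exists (L : fieldExtType rat) :
  {M : splittingFieldType rat & {iota : 'AHom(L, M) | is_galois_closure iota}}.
Proof.
pose a := primitive_elt L.
have /sig_eqW[p Dp] : exists p, minPoly 1 a = map_poly (in_alg L) p.
  by apply/polyOver1P/minPolyOver.
have [rC DrC] := closed_field_poly_normal (map_poly (ratr : rat -> algC) p).
have [Qs [QsC [rs Drs genQs]]] := num_field_exists rC.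
have p_mon : p \is monic.
  by have := monic_minPoly 1 a; rewrite Dp map_monic.
have Dprs : map_poly (in_alg Qs) p = \prod_(r <- rs) ('X - r%:P).
  apply: (map_poly_inj QsC); rewrite -map_poly_comp.
  rewrite (eq_map_poly (g := ratr)); last by move=> x /=; rewrite alg_num_field fmorph_rat.
  rewrite DrC lead_coef_map (monicP p_mon) rmorph1 scale1r -Drs big_map.
  rewrite rmorph_prod; apply: eq_bigr => r _.
  by rewrite rmorphB /= map_polyX map_polyC.
have splitQs : SplittingField.axiom Qs.
  exists (map_poly (in_alg Qs) p); first by apply/polyOver1P; exists p.
  by exists rs; rewrite ?Dprs ?eqpxx.
pose M : splittingFieldType rat :=
  HB.pack Qs (FieldExt_isSplittingField.Build rat Qs splitQs).
have [b b_rs] : {b | b \in rs}.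
  case: (rs) Dprs => [|b s]; last by exists b; rewrite mem_head.
  move/(congr1 (fun q : {poly Qs} => size q)); rewrite big_nil size_poly1.
  by rewrite size_map_poly -(size_map_poly (in_alg L)) -Dp size_minPoly.
have pb0 : fieldExt_horner b p = 0.
  by apply/eqP; rewrite fieldExt_horner_root Dprs root_prod_XsubC.
have wd q : fieldExt_horner a q = 0 -> fieldExt_horner b q = 0.
  move/eqP; rewrite fieldExt_horner_root => qa0.
  have: minPoly 1 a %| map_poly (in_alg L) q.
    by rewrite minPoly_dvdp //; apply/polyOver1P; exists q.
  by rewrite Dp dvdp_map => /dvdpP[c ->]; rewrite rmorphM /= pb0 mulr0.
have polya (y : L) : exists q, y == fieldExt_horner a q.
  have /Fadjoin1_polyP[q ->] : y \in <<1; a>>%VS by rewrite primitive_eltP memvf.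
  by exists q.
pose qa y := xchoose (polya y).
have qaK y : fieldExt_horner a (qa y) = y.
  by apply/esym/eqP; apply: (xchooseP (polya y)).
pose f (y : L) : M := fieldExt_horner b (qa y).
have fE q : f (fieldExt_horner a q) = fieldExt_horner b q.
  apply/eqP; rewrite -subr_eq0; apply/eqP.
  by rewrite -rmorphB; apply: wd; rewrite rmorphB /= qaK subrr.
have f_lin : linear f.
  by move=> k x y; rewrite -{1}[x]qaK -{1}[y]qaK -linearP fE linearP.
have f_mul : monoid_morphism f.
  split=> [|x y]; first by rewrite -(rmorph1 (fieldExt_horner a)) fE rmorph1.
  by rewrite -{1}[x]qaK -{1}[y]qaK -rmorphM fE rmorphM.
pose fLM : {lrmorphism L -> M} :=
  HB.pack f (GRing.isLinear.Build _ _ _ _ f f_lin)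
    (GRing.isMonoidMorphism.Build _ _ f f_mul).
pose iota : 'AHom(L, M) := linfun_ahom fLM.
have iotaE y : iota y = f y by rewrite lfunE.
have iota_a : iota a = b.
  by rewrite iotaE -{1}[a]fieldExt_hornerX fE fieldExt_hornerX.
exists M, iota; split=> [|E sLE /and3P[_ _ /normalFieldP nE]]; first exact: galois_rat.
have Eb : b \in E.
  by rewrite -iota_a (subvP sLE) // memv_img ?memvf.
have [r /allP Er Dr] := nE b Eb.
have Drrs : minPoly 1 b = \prod_(c <- rs) ('X - c%:P) :> {poly M}.
  rewrite -iota_a -(aimg1 iota) -map_minPoly Dp -map_poly_comp -Dprs.
  apply: eq_map_poly => x /=; rewrite iotaE.
  by rewrite -(fieldExt_hornerC a) fE fieldExt_hornerC.
apply/eqP; rewrite eqEsubv subvf /= -genQs; apply/Fadjoin_seqP; split=> [|c c_rs].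
  exact: sub1v.
apply: Er; have Drr := etrans (esym Dr) Drrs.
by rewrite -root_prod_XsubC Drr root_prod_XsubC.
Qed.

Definition galois_closure (L : fieldExtType rat) : splittingFieldType rat :=
  projT1 (galois_closure_exists L).

Definition galois_closure_embed (L : fieldExtType rat) :
    'AHom(L, galois_closure L) :=
  sval (projT2 (galois_closure_exists L)).

Lemma galois_closureP (L : fieldExtType rat) :
  is_galois_closure (galois_closure_embed L).
Proof. exact: svalP (projT2 (galois_closure_exists L)). Qed.

Definition galois_group (L : fieldExtType rat) :
    {group gal_of {:galois_closure L}} :=
  'Gal({:galois_closure L} / 1)%G.

Definition primitive_minPoly (L : fieldExtType rat) :
    {poly galois_closure L} :=
  map_poly (galois_closure_embed L) (minPoly 1 (primitive_elt L)).

Lemma primitive_roots_exist (L : fieldExtType rat) :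
  {rs : seq (galois_closure L) |
    primitive_minPoly L = \prod_(r <- rs) ('X - r%:P)}.
Proof.
apply/sig_eqW.
have [rs /eqP Drs] :=
  splitting_field_normal 1 (galois_closure_embed L (primitive_elt L)).
by exists rs; rewrite -Drs /primitive_minPoly map_minPoly aimg1.
Qed.

Definition primitive_roots (L : fieldExtType rat) : seq (galois_closure L) :=
  sval (primitive_roots_exist L).

Lemma mem_primitive_roots (L : fieldExtType rat) (x : galois_closure L) :
  (x \in primitive_roots L) = root (primitive_minPoly L) x.
Proof.
by rewrite /primitive_roots; case: primitive_roots_exist => rs /= ->;
  rewrite root_prod_XsubC.
Qed.

(* X_L as a finite type: seq_sub s is {x | x \in s}, so multiplicities in s
   would be irrelevant. *)
Definition root_type (L : fieldExtType rat) : finType :=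
  seq_sub (primitive_roots L).

Lemma gal_primitive_root (L : fieldExtType rat)
    (g : gal_of {:galois_closure L}) (x : root_type L) :
  g (ssval x) \in primitive_roots L.
Proof.
have g_gal : g \in 'Gal({:galois_closure L} / 1)%g.
  by rewrite gal_kHom ?sub1v // k1HomE ahomWin.
have p_over1 : primitive_minPoly L \is a polyOver 1%VS.
  by rewrite /primitive_minPoly map_minPoly aimg1 minPolyOver.
rewrite mem_primitive_roots -(fixedPoly_gal (sub1v _) g_gal p_over1).
by rewrite fmorph_root -mem_primitive_roots ssvalP.
Qed.

Definition gal_root (L : fieldExtType rat) (g : gal_of {:galois_closure L})
    (x : root_type L) : root_type L :=
  SeqSub (gal_primitive_root g x).

Lemma gal_root_inj (L : fieldExtType rat) (g : gal_of {:galois_closure L}) :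
  injective (gal_root g).
Proof. by move=> x y [] /fmorph_inj xy; apply: val_inj. Qed.

Definition gal_perm (L : fieldExtType rat) (g : gal_of {:galois_closure L}) :
    {perm root_type L} :=
  perm (@gal_root_inj L g).

(* porbits s is the set of all cycles of s, fixed points included. *)
Definition has_odd_cycle (T : finType) (s : {perm T}) : bool :=
  [exists c in porbits s, odd #|c|].

Definition delta (L : fieldExtType rat) : rat :=
  #|[set g in galois_group L | has_odd_cycle (gal_perm g)]|%:R
    / #|galois_group L|%:R.

(* Main.v *)
(** Take L = Q(z) with z a root of c(X^2), where
    c = X^3 - n X^2 - (n + 3) X - 1 is Shanks' simplest cubic.  The roots of c
    are permuted cyclically by rho(y) = - 1 / (1 + y) and have product 1.
    Hence the cube of a Galois automorphism fixes the three roots of c, and it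
    cannot negate all three of their square roots when these are chosen with
    product 1; so every automorphism has a cycle of length 1 or 3.

    The cubic field of c is totally ramified at each prime p <> 3 which divides
    D(n) = n^2 + 3 n + 9 exactly once, whereas L is unramified at the primes
    not dividing 6 D(n).  Since arbitrarily large primes divide values of D, a
    suitable choice of parameters gives pairwise non-isomorphic fields. *)

Require Import Defs.
From mathcomp Require Import all_boot all_order all_fingroup all_algebra.
From mathcomp Require Import all_solvable all_field.
From mathcomp Require Import ring.
Import GRing.Theory Num.Theory.
Local Open Scope ring_scope.

Set Implicit Arguments.
Unset Strict Implicit.
Unset Printing Implicit Defensive.

(** * Separable polynomials and the sextic *)

(** Write [f = h * d] with [d] the gcd of [f] and [g]. Separability makes [h] and [d] coprime, hence
    [h] and [g] coprime, so [h], which divides [g ^+ k], is constant. *)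
Lemma separable_dvdp_exp (F : fieldType) (f g : {poly F}) k :
  separable_poly f -> f %| g ^+ k -> f %| g.
Proof.
move=> /separable_polyP[sep_f _] dv_f_gk.
have /dvdpP[h Df] := dvdp_gcdl f g; set d := gcdp f g in Df *.
have co_hd : coprimep h d by apply: sep_f; rewrite -Df.
have dv_hf : h %| f by rewrite Df dvdp_mulr.
have co_hg : coprimep h g.
  apply/coprimepP => e e_h e_g; move/coprimepP: co_hd; apply=> //.
  by rewrite dvdp_gcd (dvdp_trans e_h).
have h1 : h %= 1.
  rewrite -size_poly_eq1 -dvdp1 -(Gauss_dvdpr _ (coprimep_expr k co_hg)) mulr1.
  exact: dvdp_trans dv_f_gk.
by rewrite Df (eqp_dvdl _ (eqp_mulr d h1)) mul1r dvdp_gcdr.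
Qed.

Definition sextic (R : comNzRingType) (n : R) : {poly R} :=
  'X^6 - (n *: 'X^4 + (n + 3%:R) *: 'X^2 + 1).

Lemma size_sextic_low (R : comNzRingType) (n : R) :
  (size (n *: 'X^4 + (n + 3%:R) *: 'X^2 + 1 : {poly R})%R <= 5)%N.
Proof.
rewrite (leq_trans (size_polyD _ _)) // geq_max size_poly1 andbT.
rewrite (leq_trans (size_polyD _ _)) // geq_max.
by rewrite !(leq_trans (size_scale_leq _ _)) ?size_polyXn.
Qed.

Lemma size_sextic (R : comNzRingType) (n : R) : size (sextic n) = 7.
Proof.
rewrite size_polyDl ?size_polyXn // size_polyN ltnS.
by rewrite (leq_trans (size_sextic_low n)).
Qed.

Lemma monic_sextic (R : comNzRingType) (n : R) : sextic n \is monic.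
Proof.
rewrite monicE lead_coefDl ?lead_coefXn // size_polyN size_polyXn ltnS.
by rewrite (leq_trans (size_sextic_low n)).
Qed.

Lemma map_sextic (R S : comNzRingType) (f : {rmorphism R -> S}) (n : R) :
  map_poly f (sextic n) = sextic (f n).
Proof.
by rewrite rmorphB !rmorphD /= !map_polyZ /= !map_polyXn rmorph1 rmorphD
  rmorph_nat.
Qed.

Lemma horner_sextic (R : comNzRingType) (n x : R) :
  (sextic n).[x] = x ^+ 6 - (n * x ^+ 4 + (n + 3%:R) * x ^+ 2 + 1).
Proof. by rewrite !hornerE. Qed.

(** The derivative is [2 X c'(X^2)] with [c] the cubic, and [X] is coprime to the sextic because the
    constant term is [-1]. *)
Lemma separable_sextic (F : fieldType) (n : F) :
  6%:R != 0 :> F -> n ^+ 2 + 3%:R * n + 9%:R != 0 -> separable_poly (sextic n).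
Proof.
move=> nz6 nzD; set D := _ + _ in nzD.
have nz2 : 2%:R != 0 :> F by apply: contraNneq nz6 => e;
  rewrite (natrM _ 2 3) e mul0r.
have nz3 : 3%:R != 0 :> F by apply: contraNneq nz6 => e;
  rewrite (natrM _ 2 3) e mulr0.
rewrite unlock -/(coprimep _ _).
pose c' : {poly F} := 3%:R *: 'X^4 - ((2%:R * n) *: 'X^2 + (n + 3%:R)%:P).
have -> : (sextic n)^`() = 2%:R *: ('X * c').
  rewrite /sextic /c' !derivE -!mul_polyC !polyCD !polyCM !polyC_natr /=; ring.
rewrite coprimepZr // coprimepMr; apply/andP; split.
  apply/Bezout_coprimepP; exists (-1, 'X^5 - (n *: 'X^3 + (n + 3%:R) *: 'X)).
  rewrite [X in X %= _](_ : _ = 1) ?eqpxx // /sextic /= -!mul_polyC !polyCD.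
  ring.
(* Euclid on the cubic c and its derivative c' (here evaluated at X^2):
   9 c = (3 X - n) c' - D (2 X + 1) and 4 c' = (2 X + 1) (6 X - 4 n - 3) - 9. *)
apply/Bezout_coprimepP.
pose l : {poly F} := 6%:R *: 'X^2 - (4%:R * n + 3%:R)%:P.
exists (- 9%:R *: l, (3%:R *: 'X^2 - n%:P) * l - (4%:R * D)%:P).
rewrite [X in X %= _](_ : _ = (9%:R * D)%:P).
  by rewrite polyC_eqp1 mulf_neq0 // (natrM _ 3 3) mulf_neq0.
rewrite /sextic /= /l /D /c' -!mul_polyC.
rewrite !(polyCD, polyCM, polyCN, polyC_exp, polyC_natr).
ring.
Qed.

(** * Reduction modulo a prime *)

Lemma polyFp_eq0 (p : nat) (g : {poly int}) :
  prime p -> map_poly (intr : int -> 'F_p) g = 0 ->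
  exists h, g = p%:Z *: h.
Proof.
move=> pr_p g0; exists (\poly_(i < size g) (g`_i %/ p)%Z).
apply/polyP=> i; rewrite coefZ coef_poly.
case: ltnP => [_ | /(nth_default 0) ->]; last by rewrite mulr0.
rewrite mulrC divzK // (dvdz_pcharf (pchar_Fp pr_p)).
by rewrite -coef_map_id0 ?g0 ?coef0 ?rmorph0.
Qed.

(** Division by the monic [f] is compatible with reduction: modulo [p] the remainder is a multiple
    of [f] of smaller degree, hence zero. *)
Lemma dvdp_Fp_lift (p : nat) (f g : {poly int}) :
    prime p -> f \is monic ->
    map_poly (intr : int -> 'F_p) f %| map_poly intr g ->
  exists q h, g = q * f + p%:Z *: h.
Proof.
move=> pr_p mon_f dv_fg.
have Dg := Pdiv.IdomainMonic.divp_eq mon_f g.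
have mon_fp : map_poly (intr : int -> 'F_p) f \is monic by rewrite monic_map.
have /(polyFp_eq0 pr_p)[h Dr] : map_poly (intr : int -> 'F_p) (g %% f) = 0.
  apply/eqP/negPn/negP => nz_r.
  have: map_poly (intr : int -> 'F_p) f %| map_poly intr (g %% f).
    by move: dv_fg; rewrite {1}Dg rmorphD rmorphM /= dvdp_addr ?dvdp_mull.
  move/(dvdp_leq nz_r); apply/negP; rewrite -ltnNge.
  rewrite (leq_ltn_trans (size_poly _ _)) //.
  rewrite [X in (_ < X)%N](_ : _ = size f) ?ltn_modpN0 ?monic_neq0 //.
  by rewrite size_map_poly_id0 // (monicP mon_f) rmorph1 oner_neq0.
by exists (g %/ f), h; rewrite -Dr.
Qed.

Lemma intr_fieldExt_eq0 (L : fieldExtType rat) (m : int) :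
  (m%:~R == 0 :> L) = (m == 0).
Proof. by rewrite -(rmorph_int (in_alg L)) fmorph_eq0 intr_eq0. Qed.

(* Separability makes Z[z]/p reduced.  Hence an element of Z[z] whose cube is
   divisible by p is itself divisible by p, which first removes p from the
   denominator of beta and then forces beta^3 into p^3 Z[z]. *)
Lemma separable_Eisenstein_cubic (L : fieldExtType rat) (z beta : L)
    (f : {poly int}) (p : nat) (a b : int) :
    f \is monic -> root (map_poly intr f) z ->
    (forall r : {poly int},
      (size r < size f)%N -> root (map_poly intr r) z -> r = 0) ->
    prime p -> separable_poly (map_poly (intr : int -> 'F_p) f) ->
    beta \in <<1; z>>%VS ->
    beta ^+ 3 = p%:R * (a%:~R * beta + b%:~R) ->
  (p %| b)%Z.
Proof.
move=> mon_f /rootP fz0 min_f pr_p sep_f z_beta Dbeta.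
pose ev : {rmorphism {poly int} -> L} :=
  horner_eval z \o map_poly (intr : int -> L).
have evE q : (map_poly intr q).[z] = ev q by [].
have evf0 : ev f = 0 by [].
have evC c : ev c%:P = c%:~R by rewrite -evE map_polyC hornerC.
have sz_f (R : nzRingType) : size (map_poly (intr : int -> R) f) = size f.
  by rewrite size_map_poly_id0 // (monicP mon_f) rmorph1 oner_neq0.
have fp_gt1 : (1 < size (map_poly (intr : int -> 'F_p) f))%N.
  rewrite sz_f -(sz_f L); apply: (@root_size_gt1 _ z); last exact/rootP.
  by rewrite monic_neq0 ?monic_map.
have ev0 g : ev g = 0 -> map_poly (intr : int -> 'F_p) f %| map_poly intr g.
  move=> gz0; rewrite (Pdiv.IdomainMonic.divp_eq mon_f g) [g %% f]min_f.
  - by rewrite addr0 rmorphM dvdp_mull.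
  - by rewrite ltn_modpN0 ?monic_neq0.
  have:= gz0; rewrite {1}(Pdiv.IdomainMonic.divp_eq mon_f g).
  by rewrite rmorphD rmorphM evf0 mulr0 add0r => /rootP.
pose mp : {rmorphism {poly int} -> {poly 'F_p}} := map_poly intr.
have mpC c : mp c%:P = (c%:~R)%:P by rewrite -[LHS]/(map_poly _ _) map_polyC.
have p0 : p%:R = 0 :> {poly 'F_p}.
  by rewrite -polyC_natr (pcharf0 (pchar_Fp pr_p)).
have red d g : d%:~R * beta = ev g -> exists h, ev g = p%:R * ev h.
  (* [w] vanishes at [z] and reduces to [g ^+ 3] modulo [p]. *)
  move=> Dg; pose w := g ^+ 3 - p%:R * ((a * d ^+ 2)%:P * g + (b * d ^+ 3)%:P).
  have /ev0 : ev w = 0.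
    rewrite /w rmorphB rmorphXn rmorphM rmorphD rmorphM !evC rmorph_nat -Dg.
    rewrite exprMn Dbeta; ring.
  have -> : map_poly intr w = map_poly intr g ^+ 3 :> {poly 'F_p}.
    rewrite -![map_poly _ _]/(mp _) /w rmorphB rmorphXn rmorphM rmorph_nat.
    by rewrite p0 mul0r subr0.
  move/(separable_dvdp_exp sep_f)/(dvdp_Fp_lift pr_p mon_f) => [q [h ->]].
  exists h; rewrite -mul_polyC rmorphD !rmorphM evC.
  by rewrite evf0 mulr0 add0r.
have nz_p : p%:R != 0 :> L.
  by rewrite -[p%:R]/(p%:Z%:~R) intr_fieldExt_eq0; case: (p) pr_p.
have [d [g [p'd Dg]]] : exists d g, ~~ (p %| d)%Z /\ d%:~R * beta = ev g.
  have [q Dbq] := Fadjoin1_polyP z_beta.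
  have [g [d nz_d Dq]] := rat_poly_scale q.
  have {Dq Dbq q} : d%:~R * beta = ev g.
    rewrite Dbq Dq map_polyZ hornerZ mulrA -(rmorph_int (in_alg L)) -rmorphM.
    rewrite mulfV ?intr_eq0 // rmorph1 mul1r -map_poly_comp -evE.
    by congr _.[z]; apply: eq_map_poly => x /=;
      rewrite -(rmorph_int (in_alg L)).
  (* Each factor [p] of the denominator [d] cancels by [red]; this terminates since [|d|]
     decreases. *)
  have [m] := ubnP `|d|%N; elim: m => // m IHm in d g nz_d *.
  rewrite ltnS => le_dm Dg.
  have [/dvdzP[e De] | p'd] := boolP (p %| d)%Z; last by exists d, g.
  have [h Dh] := red d g Dg.
  apply: (IHm e h).
  - by apply: contraNneq nz_d => e0; rewrite De e0 mul0r.
  - apply: leq_trans le_dm; rewrite De abszM ltn_Pmulr ?prime_gt1 // absz_gt0.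
    by apply: contraNneq nz_d => e0; rewrite De e0 mul0r.
  apply: (mulfI nz_p); rewrite -Dh -Dg De rmorphM; ring.
have [h Dh] := red d g Dg.
(* Substituting [p h(z)] for [d beta] in the cubic equation and cancelling [p] leaves a polynomial
   congruent to the constant [- b d^3], which [f], of positive degree, must divide modulo [p]. *)
have /ev0 :
    ev (p%:R * (p%:R * h ^+ 3 - (a * d ^+ 2)%:P * h) - (b * d ^+ 3)%:P) = 0.
  rewrite rmorphB rmorphM rmorphB evC [ev (_ * h)]rmorphM evC.
  rewrite [ev (_ * _ ^+ 3)]rmorphM rmorphXn !rmorph_nat.
  apply: (mulfI nz_p); rewrite mulr0.
  transitivity ((p%:R * ev h) ^+ 3 -
      p%:R * (a%:~R * d%:~R ^+ 2 * (p%:R * ev h) + b%:~R * d%:~R ^+ 3)).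
    ring.
  rewrite -Dh -Dg exprMn Dbeta; ring.
rewrite -[map_poly _ (_ - _)]/(mp _) rmorphB rmorphM rmorph_nat p0.
rewrite mul0r sub0r mpC dvdpNr => dv_f.
have bd0 : (b * d ^+ 3)%:~R = 0 :> 'F_p.
  apply/eqP/negPn/negP => nz_bd; have := dvdp_leq _ dv_f.
  rewrite polyC_eq0 size_polyC nz_bd => /(_ isT).
  by rewrite leqNgt fp_gt1.
move/eqP: bd0; rewrite -(dvdz_pcharf (pchar_Fp pr_p)) dvdzE abszM abszX /=.
rewrite Euclid_dvdM // Euclid_dvdX // andbT => /orP[|pd];
  first by rewrite dvdzE.
by rewrite dvdzE pd in p'd.
Qed.

(** * The cubic and the degree of the sextic field *)

Definition cubic (R : comNzRingType) (n : R) : {poly R} :=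
  'X^3 - (n *: 'X^2 + (n + 3%:R) *: 'X + 1).

Lemma size_cubic (R : comNzRingType) (n : R) : size (cubic n) = 4.
Proof.
rewrite size_polyDl ?size_polyXn // size_polyN ltnS.
rewrite (leq_trans (size_polyD _ _)) // geq_max size_poly1 andbT.
rewrite (leq_trans (size_polyD _ _)) // geq_max.
by rewrite !(leq_trans (size_scale_leq _ _)) ?size_polyXn ?size_polyX.
Qed.

Lemma horner_cubic (R : comNzRingType) (n x : R) :
  (cubic n).[x] = x ^+ 3 - (n * x ^+ 2 + (n + 3%:R) * x + 1).
Proof. by rewrite !hornerE. Qed.

Lemma map_cubic (R S : comNzRingType) (f : {rmorphism R -> S}) (n : R) :
  map_poly f (cubic n) = cubic (f n).
Proof.
rewrite rmorphB !rmorphD /= !map_polyZ /= !map_polyXn map_polyX rmorph1.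
by rewrite rmorphD rmorph_nat.
Qed.

Lemma root_sextic_cubic (R : comNzRingType) (n x : R) :
  root (sextic n) x = root (cubic n) (x ^+ 2).
Proof. by rewrite /root horner_sextic horner_cubic -!exprM. Qed.

(* A root a / b in lowest terms would satisfy the homogenised equation, which
   modulo 2 has only the trivial solution. *)
Lemma irreducible_cubic (n : nat) : irreducible_poly (cubic (n%:R : rat)).
Proof.
apply: cubic_irreducible => [|x]; first by rewrite size_cubic.
apply/negP; rewrite /root horner_cubic => /eqP x0.
have nz_d : (denq x)%:~R != 0 :> rat by rewrite intr_eq0 denq_neq0.
have Eab : numq x ^+ 3 = n%:R * numq x ^+ 2 * denq x
    + (n%:R + 3%:R) * numq x * denq x ^+ 2 + denq x ^+ 3.
  apply: (@intr_inj rat); set N := numq x; set d := denq x.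
  transitivity (N%:~R ^+ 3 : rat); first by ring.
  have -> : N%:~R = x * d%:~R by rewrite -{1}[x]divq_num_den divfK.
  transitivity ((x ^+ 3 - (n%:R * x ^+ 2 + (n%:R + 3%:R) * x + 1)) * d%:~R ^+ 3
    + n%:R * (x * d%:~R) ^+ 2 * d%:~R
    + (n%:R + 3%:R) * (x * d%:~R) * d%:~R ^+ 2 + d%:~R ^+ 3); first by ring.
  have <- : N%:~R = x * d%:~R by rewrite -{1}[x]divq_num_den divfK.
  by rewrite x0; ring.
have pr2 : prime 2 by [].
have /andP[a2 b2] : ((numq x)%:~R == 0 :> 'F_2) && ((denq x)%:~R == 0 :> 'F_2).
  have: (numq x)%:~R ^+ 3 = n%:R * (numq x)%:~R ^+ 2 * (denq x)%:~R
    + (n%:R + 3%:R) * (numq x)%:~R * (denq x)%:~R ^+ 2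
    + (denq x)%:~R ^+ 3 :> 'F_2.
    transitivity ((numq x ^+ 3)%:~R : 'F_2); first by ring.
    by rewrite Eab; ring.
  move: (_%:~R) (_%:~R) (n%:R : 'F_2).
  by do 3!case=> [[|[|]]] // ? .
rewrite -!(dvdz_pcharf (pchar_Fp pr2)) !dvdzE in a2 b2.
have: (2 %| gcdn `|numq x| `|denq x|)%N by rewrite dvdn_gcd; apply/andP.
by rewrite (eqP (coprime_num_den x)).
Qed.

(* If z were in Q(z^2), its minimal polynomial X^3 + u X^2 + v X + w would give
   (z^3 + v z)^2 = (u z^2 + w)^2, a cubic relation for z^2; comparing it with
   the cubic yields (v - 1)^2 + (u - w)^2 + 1 = 0 over Q. *)
Lemma dim_sextic (L : fieldExtType rat) (n : nat) (z : L) :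
  root (sextic n%:R) z -> \dim <<1; z>> = 6.
Proof.
rewrite root_sextic_cubic; set y := z ^+ 2 => y0.
have cL : cubic n%:R = map_poly (in_alg L) (cubic n%:R)
  by rewrite map_cubic rmorph_nat.
have deg_y : adjoin_degree 1%AS y = 3.
  have /polyOver1P[q Dq] := minPolyOver 1%AS y.
  apply: succn_inj; rewrite -size_minPoly Dq size_map_poly.
  have: minPoly 1 y %| cubic n%:R.
    by rewrite minPoly_dvdp // cL; apply/polyOver1P; exists (cubic n%:R).
  rewrite cL Dq dvdp_map => /(irreducible_cubic n).2 /eqp_size -> //.
    exact: size_cubic.
  by rewrite -(size_map_poly (in_alg L)) -Dq size_minPoly.
have dim_y : \dim <<1; y>> = 3 by rewrite dim_Fadjoin deg_y dimv1.
have sub_yz : (<<1; y>> <= <<1; z>>)%VS.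
  by apply/FadjoinP; rewrite subv_adjoin rpredX // memv_adjoin.
have Dz : <<<<1; y>>; z>>%VS = <<1; z>>%VS.
  apply/eqP; rewrite eqEsubv; apply/andP; split; apply/FadjoinP.
    by rewrite sub_yz memv_adjoin.
  by rewrite memv_adjoin (subv_trans (subv_adjoin _ y)) ?subv_adjoin.
have deg_z_le : (adjoin_degree <<1; y>>%AS z <= 2)%N.
  rewrite -ltnS -size_minPoly -(size_XnsubC y (isT : 0 < 2)%N) dvdp_leq //.
    by rewrite -size_poly_eq0 size_XnsubC.
  apply: minPoly_dvdp; last by rewrite /root !hornerE subrr.
  by rewrite rpredB ?rpredX ?polyOverX // polyOverC memv_adjoin.
suffices Nyz : z \notin <<1; y>>%VS.
  have := dim_Fadjoin <<1; y>>%AS z; rewrite Dz dim_y => ->.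
  move: Nyz; rewrite -(adjoin_deg_eq1 <<1; y>>%AS) => Nyz.
  have : (0 < adjoin_degree <<1; y>>%AS z)%N by [].
  by move: deg_z_le Nyz; case: adjoin_degree => [|[|[|]]].
apply/negP => yz.
have dim_z : \dim <<1; z>> = 3.
  by rewrite -Dz -dim_y; congr (\dim _); apply/eqP;
    rewrite eqEsubv subv_adjoin andbT; apply/FadjoinP.
have deg_z : adjoin_degree 1%AS z = 3.
  by have := dim_Fadjoin 1%AS z; rewrite dim_z dimv1 muln1.
have /polyOver1P[g Dg] := minPolyOver 1%AS z.
have sz_g : size g = 4 by rewrite -(size_map_poly (in_alg L)) -Dg size_minPoly
  deg_z.
have mon_g : g \is monic by rewrite -(map_monic (in_alg L)) -Dg monic_minPoly.
have g3 : g`_3 = 1 by move/monicP: mon_g; rewrite lead_coefE sz_g.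
have := minPolyxx 1%AS z; rewrite Dg horner_coef size_map_poly sz_g.
rewrite !big_ord_recr big_ord0 /= !coef_map /= g3 scale1r.
set u := g`_2; set v := g`_1; set w := g`_0 => gz.
(* Coefficients of the relation for [y], once the cubic has eliminated [y ^+ 3]. *)
pose A := 2%:R * v - u ^+ 2 + n%:R;
  pose B := v ^+ 2 - 2%:R * u * w + n%:R + 3%:R.
pose C := 1 - w ^+ 2; pose h := A *: 'X^2 + B *: 'X + C%:P.
pose i : {rmorphism rat -> L} := in_alg L.
rewrite -![_%:A]/(i _) in gz.
have h0 : h = 0.
  apply/eqP/negPn/negP; rewrite -(map_poly_eq0 (in_alg L)) => nz_h.
  have: minPoly 1 y %| map_poly (in_alg L) h.
    apply: minPoly_dvdp; first by apply/polyOver1P; exists h.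
    rewrite /root /h 2!rmorphD /= !map_polyZ /= map_polyXn map_polyX map_polyC
      /=.
    rewrite !hornerD !hornerZ hornerXn hornerX hornerC -![_%:A]/(i _).
    move: y0; rewrite /root horner_cubic => /eqP y0; apply/eqP.
    set Z3 := z ^+ 3 in gz.
    transitivity ((Z3 + i v * z + (i u * z ^+ 2 + i w)) *
      (Z3 + i v * z - (i u * z ^+ 2 + i w))
      - (y ^+ 3 - (n%:R * y ^+ 2 + (n%:R + 3%:R) * y + 1))).
      rewrite /Z3 /y /A /B /C; ring.
    rewrite y0 subr0 [X in X * _](_ : _ = 0) ?mul0r // -gz; ring.
  move/(dvdp_leq nz_h); rewrite size_minPoly deg_y size_map_poly leqNgt ltnS.
  rewrite (leq_trans (size_polyD _ _)) // geq_max.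
  rewrite (leq_trans (size_polyC_leq1 _)) // andbT.
  rewrite (leq_trans (size_polyD _ _)) // geq_max.
  by rewrite !(leq_trans (size_scale_leq _ _)) ?size_polyXn ?size_polyX.
have coef_h k : h`_k = 0 by rewrite h0 coef0.
move: (coef_h 0%N) (coef_h 1%N) (coef_h 2%N).
rewrite /h !(coefD, coefZ, coefXn, coefX, coefC) /= !(mulr0, mulr1).
rewrite !(addr0, add0r).
move=> e0 e1 e2.
have : (v - 1) ^+ 2 + (u - w) ^+ 2 + 1 = 0 :> rat.
  transitivity (B - A - C); first by rewrite /A /B /C; ring.
  by rewrite e0 e1 e2; ring.
apply/eqP/lt0r_neq0.
by rewrite ltr_wpDl ?ltr01 // addr_ge0 ?sqr_ge0.
Qed.

Lemma sextic_field_exists (n : nat) :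
  {L : fieldExtType rat &
    {z : L | root (sextic n%:R) z & <<1; z>>%VS = {:L}%VS}}.
Proof.
have /closed_rootP/sigW[w w0] : size (sextic (n%:R : algC)) != 1%N
  by rewrite size_sextic.
have [L [LC [[|z [|? ?]] //= [Dz] genL]]] := num_field_exists [:: w].
exists L, z; last by rewrite -adjoin_seq1.
by rewrite -(fmorph_root LC) map_sextic rmorph_nat Dz.
Qed.

(** The minimal polynomial divides the sextic and both have degree 6. *)
Lemma minPoly_sextic (L : fieldExtType rat) (n : nat) (z : L) :
  root (sextic n%:R) z -> minPoly 1 z = sextic n%:R.
Proof.
move=> z0.
have sL : sextic n%:R = map_poly (in_alg L) (sextic n%:R)
  by rewrite map_sextic rmorph_nat.
have: minPoly 1 z %| sextic n%:R.
  by rewrite minPoly_dvdp // sL; apply/polyOver1P; exists (sextic n%:R).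
move/dvdp_size_eqp; rewrite size_sextic size_minPoly.
have := dim_Fadjoin 1%AS z; rewrite (dim_sextic z0) dimv1 muln1 => <-.
by rewrite eqxx eqp_monic ?monic_minPoly ?monic_sextic // => /esym/eqP.
Qed.

Lemma sextic_dvdp (L : fieldExtType rat) (n : nat) (z : L) (q : {poly rat}) :
  root (sextic n%:R) z -> root (map_poly (in_alg L) q) z -> sextic n%:R %| q.
Proof.
move=> z0 qz0; rewrite -(dvdp_map (in_alg L)) map_sextic rmorph_nat.
by rewrite -(minPoly_sextic z0) minPoly_dvdp //; apply/polyOver1P; exists q.
Qed.

(** * Odd cycles and [delta] *)

(** The orbit length is 1 or 3: any other length would repeat [x] in the duplicate-free list of its
    orbit. *)
Lemma odd_porbit_iter3 (T : finType) (s : {perm T}) (x : T) :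
  iter 3 s x = x -> odd #|porbit s x|.
Proof.
move=> s3x.
have lt0 := card_porbit_neq0 s x; have := uniq_traject_porbit s x.
have := iter_porbit s x; case Dm: #|porbit s x| lt0 => [|[|[|[|m]]]] //=.
  by move=> _ s2x; rewrite /= s2x in s3x; rewrite s3x inE eqxx.
by move=> _ _; rewrite /= in s3x; rewrite s3x !inE eqxx !orbT.
Qed.

Lemma delta_eq1 (L : fieldExtType rat) :
    (forall g : gal_of {:galois_closure L},
      exists x : root_type L, iter 3 (gal_perm g) x = x) ->
  delta L = 1.
Proof.
move=> fix3; rewrite /delta.
have -> : [set g in galois_group L | has_odd_cycle (gal_perm g)]
    = galois_group L :> {set _}.
  apply/setP=> g; rewrite inE andb_idr // => _.
  have [x /odd_porbit_iter3 odd_x] := fix3 g.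
  by apply/existsP; exists (porbit (gal_perm g) x); rewrite odd_x andbT imset_f.
by rewrite divff // pnatr_eq0 -lt0n cardG_gt0.
Qed.

(** * The cyclic action on the roots of the cubic *)

Section CubicRoots.

Variables (F : fieldType) (n : F).

Let rho (x : F) := - (1 + x)^-1.

Lemma root_cubic_neq (y : F) : root (cubic n) y -> y != 0 /\ 1 + y != 0.
Proof.
rewrite /root horner_cubic => /eqP y0; split.
  by apply: contra_eq_neq y0 => ->;
    rewrite !expr0n !mulr0 !add0r oppr_eq0 oner_eq0.
apply: contra_eq_neq y0 => /eqP; rewrite addrC addr_eq0 => /eqP->.
by rewrite (_ : _ - _ = 1) ?oner_eq0 //; ring.
Qed.

Lemma root_cubic_rho (y : F) : root (cubic n) y -> root (cubic n) (rho y).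
Proof.
move=> y0; have [_ nz_y1] := root_cubic_neq y0.
move: y0; rewrite /root !horner_cubic => /eqP y0; apply/eqP.
(* The cubic at [rho y] is [- (1 + y) ^- 3] times the cubic at [y]. *)
rewrite -[RHS](mulr0 (- (1 + y) ^- 3)) -y0 /rho; field.
by [].
Qed.

Lemma rho2 (y : F) : root (cubic n) y -> rho (rho y) = - (1 + y) / y.
Proof.
by move=> /root_cubic_neq[nz0 nz1]; rewrite /rho; field; rewrite nz0 nz1.
Qed.

Lemma rho3 (y : F) : root (cubic n) y -> rho (rho (rho y)) = y.
Proof.
move=> y0; have [nz0 nz1] := root_cubic_neq y0.
rewrite (rho2 y0) /rho; field.
by rewrite nz0 (_ : y - (1 + y) = -1) ?oppr_eq0 ?oner_eq0 //; ring.
Qed.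

(** The roots have product 1; here this is solved for the third root. *)
Lemma root_cubic_prod (y : F) :
  root (cubic n) y -> (y * rho y)^-1 = rho (rho y).
Proof.
move=> y0; rewrite (rho2 y0) /rho.
by rewrite invfM invrN invrK mulrN mulNr mulrC.
Qed.

Lemma root_cubicP (x y : F) : root (cubic n) y -> root (cubic n) x ->
  [\/ x = y, x = rho y | x = rho (rho y)].
Proof.
move=> y0 x0; have [nz0 nz1] := root_cubic_neq y0.
have: (x - y) * (x - rho y) * (x - rho (rho y)) = 0.
  rewrite (rho2 y0); move: y0 x0;
    rewrite /root !horner_cubic => /eqP y0 /eqP x0.
  (* Solving the equation of [y] for [n] turns the factorization of the cubic into an identity of
     rational functions in [x] and [y]. *)
  have Dn : n = (y ^+ 3 - 3%:R * y - 1) / (y * (1 + y)).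
    apply: (canRL (mulfK _)); first by rewrite mulf_neq0.
    by rewrite -[RHS]subr0 -y0; ring.
  by rewrite -x0 Dn /rho; field; rewrite ?nz0 ?nz1 /=.
move/eqP; rewrite !mulf_eq0 !subr_eq0 => /orP[/orP[]|] /eqP ->;
  [exact: Or31 | exact: Or32 | exact: Or33].
Qed.

End CubicRoots.

(** * Automorphisms of the Galois closure *)

Lemma sextic_comp (R : comNzRingType) (n : R) : sextic n = cubic n \Po 'X^2.
Proof.
rewrite /cubic comp_polyB !comp_polyD !comp_polyZ !comp_Xn_poly comp_polyX.
by rewrite comp_polyC -!exprM.
Qed.

Lemma gal_horner_alg (M : splittingFieldType rat) (g : gal_of {:M})
    (q : {poly rat}) (r : M) :
  g (map_poly (in_alg M) q).[r] = (map_poly (in_alg M) q).[g r].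
Proof.
rewrite -horner_map -map_poly_comp; congr _.[_]; apply: eq_map_poly => a /=.
by rewrite linearZ rmorph1.
Qed.

Section SexticDelta.

Variables (L : fieldExtType rat) (n : nat) (z : L).
Hypotheses (z0 : root (sextic n%:R) z) (genL : <<1; z>>%VS = {:L}%VS).

Let M := galois_closure L.
Let iota := galois_closure_embed L.

(** By normality the sextic, as minimal polynomial of [iota z], splits over [M]; its factor
    ['X^2 - y%:P] therefore has a root there. *)
Lemma sextic_galois_closure_split (y : M) :
  root (cubic n%:R) y -> exists t, t ^+ 2 = y.
Proof.
move=> y0; have s0 : root (sextic n%:R) (iota z).
  by rewrite -(rmorph_nat iota n) -map_sextic fmorph_root.
have [rs /eqP Drs] := splitting_field_normal 1 (iota z).
have: 'X^2 - y%:P %| sextic n%:R.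
  rewrite sextic_comp -[_ - _](_ : ('X - y%:P) \Po 'X^2 = _); last first.
    by rewrite rmorphB /= comp_polyX comp_polyC.
  by rewrite dvdp_comp_poly // -root_factor_theorem.
rewrite -(minPoly_sextic s0) Drs => /dvdp_prod_XsubC[m].
case: (mask m rs) => [|t ts].
  by rewrite big_nil => /eqp_size; rewrite size_XnsubC // size_poly1.
rewrite big_cons => /eqp_root/(_ t); rewrite rootM root_XsubC eqxx /=.
by rewrite /root !hornerE subr_eq0 => /eqP; exists t.
Qed.

(** [g] commutes with [rho] and sends [y] to some [rho]-iterate of [y], so its cube acts on [y] as a
    power of [rho^3], which is the identity on roots. *)
Lemma gal_fix_cubic_root (g : gal_of {:M}) (y : M) :
  root (cubic n%:R) y -> g (g (g y)) = y.
Proof.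
move=> y0; have gy0 : root (cubic n%:R) (g y).
  by rewrite -(rmorph_nat g n) -map_cubic fmorph_root.
have g_rho x : g (- (1 + x)^-1) = - (1 + g x)^-1.
  by rewrite rmorphN fmorphV rmorphD rmorph1.
have [e | e | e] := root_cubicP y0 gy0.
- by rewrite !e.
- by rewrite e !g_rho e !g_rho e (rho3 y0).
rewrite e !g_rho e !g_rho e.
by rewrite !(rho3 y0).
Qed.

(* g^3 acts by signs on square roots of the three roots of the cubic, and these
   square roots can be chosen with product 1, so it cannot negate all three. *)
Lemma gal_fix_sextic_root (g : gal_of {:M}) :
  exists2 r : M, root (sextic n%:R) r & g (g (g r)) = r.
Proof.
have s0 : root (sextic n%:R) (iota z).
  by rewrite -(rmorph_nat iota n) -map_sextic fmorph_root.
set s := iota z in s0.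
have y0 : root (cubic n%:R) (s ^+ 2) by rewrite -root_sextic_cubic.
have y1 := root_cubic_rho y0.
have [t Dt] := sextic_galois_closure_split y1.
have sgn r : root (cubic n%:R) (r ^+ 2) -> g (g (g r)) = r \/ g (g (g r)) = - r.
  move=> /(gal_fix_cubic_root g) /eqP; rewrite !rmorphXn eqf_sqr.
  by case/orP=> /eqP; [left | right].
have t0 : root (sextic n%:R) t by rewrite root_sextic_cubic Dt.
have [gs | gs] := sgn s y0; first by exists s.
have [|gt | gt] := sgn t; first by rewrite Dt.
  by exists t.
exists (s * t)^-1; last by rewrite !fmorphV !rmorphM /= gs gt mulrNN.
rewrite root_sextic_cubic exprVn exprMn Dt.
rewrite (root_cubic_prod y0).
exact: root_cubic_rho.
Qed.

(** [delta] refers to the conjugates of the chosen primitive element [q(z)], not to those of [z].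
    Evaluating [q] carries roots of the sextic to these conjugates and commutes with automorphisms,
    so a point fixed by [g^3] is transported. *)
Lemma delta_sextic : delta L = 1.
Proof.
apply: delta_eq1 => g; have [r r0 gr] := gal_fix_sextic_root g.
have /Fadjoin1_polyP[q Dq] : primitive_elt L \in <<1; z>>%VS.
  by rewrite genL memvf.
pose x := (map_poly (in_alg M) q).[r].
have x_root : x \in primitive_roots L.
  rewrite mem_primitive_roots /primitive_minPoly.
  have /polyOver1P[m Dm] := minPolyOver 1%AS (primitive_elt L).
  have: sextic n%:R %| m \Po q.
    apply: (sextic_dvdp z0); rewrite map_comp_poly /root horner_comp -Dq -Dm.
    exact: root_minPoly.
  rewrite -(dvdp_map (in_alg M)) map_sextic rmorph_nat => /root_dvdp/(_ r0).
  rewrite map_comp_poly /root horner_comp Dm -map_poly_comp.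
  congr (_.[_] == _); apply: eq_map_poly => a /=.
  by rewrite linearZ rmorph1.
exists (SeqSub x_root); apply: val_inj => /=.
by rewrite !permE /= !gal_horner_alg gr.
Qed.

End SexticDelta.

(** * Ramified primes and non-isomorphic fields *)

(* The discriminant of the cubic is the square of this number. *)
Definition conductor (n : nat) : nat := (n ^ 2 + 3 * n + 9)%N.

(** With [D = conductor n], the identity [4 D = (2 n + 3)^2 + 27] shows that [p] divides 27. *)
Lemma conductor_dvd_deriv (p n : nat) :
  prime p -> (p %| conductor n)%N -> (p %| 2 * n + 3)%N -> p = 3.
Proof.
move=> pr_p pD pd.
have : (p %| 3 ^ 3)%N.
  have E : (4 * conductor n = (2 * n + 3) * (2 * n + 3) + 3 ^ 3)%N.
    by rewrite /conductor; ring.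
  by rewrite -(dvdn_addr _ (dvdn_mull (2 * n + 3) pd)) -E dvdn_mull.
by rewrite Euclid_dvdX // andbT dvdn_prime2 // => /eqP.
Qed.

(* With y = x ^ 2 and D = conductor n, the element 3 y - n of Q(x) satisfies
   X ^ 3 = 3 D X + (2 n + 3) D, which is Eisenstein at p. *)
Lemma sextic_no_root (L : fieldExtType rat) (m n p : nat) (z x : L) :
    root (sextic m%:R) z -> <<1; z>>%VS = {:L}%VS ->
    prime p -> ~~ (p %| 6 * conductor m)%N ->
    (p %| conductor n)%N -> ~~ (p ^ 2 %| conductor n)%N ->
  ~~ root (sextic n%:R) x.
Proof.
move=> z0 genL pr_p p'm p_n p2'n; apply/negP.
rewrite root_sextic_cubic /root horner_cubic; set y := x ^+ 2 => /eqP y0.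
have /dvdnP[d Dd] := p_n.
pose beta : L := 3%:R * y - n%:R.
have Dbeta :
    beta ^+ 3 = p%:R * ((3 * d)%:Z%:~R * beta + ((2 * n + 3) * d)%:Z%:~R).
  transitivity
    (3%:R * (conductor n)%:R * beta + (2 * n + 3)%:R * (conductor n)%:R).
    rewrite -[LHS]subr0 -[X in _ - X](mulr0 27%:R) -y0 /beta /conductor.
    ring.
  by rewrite Dd; ring.
move: p'm; rewrite Euclid_dvdM // negb_or => /andP[p'6 p'm].
have p_char := pchar_Fp pr_p.
have := @separable_Eisenstein_cubic L z beta (sextic m%:R) p _ _ _ _ _ pr_p _ _
  Dbeta.
rewrite !map_sextic !rmorph_nat monic_sextic z0 genL memvf => /(_ isT isT) pb.
have {pb} : (p %| ((2 * n + 3) * d)%:Z)%Z.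
  apply: pb => // [r|].
    rewrite size_sextic => lt_r7.
    have -> :
        map_poly intr r = map_poly (in_alg L) (map_poly intr r) :> {poly L}.
      by rewrite -map_poly_comp; apply: eq_map_poly => a /=;
        rewrite -(rmorph_int (in_alg L)).
    move/(sextic_dvdp z0) => dv_r; apply: (map_inj_poly (@intr_inj rat)) => //.
    rewrite map_poly0; apply: contraTeq lt_r7 => nz_r; rewrite -leqNgt.
    by rewrite -(size_sextic (m%:R : rat)) (leq_trans (dvdp_leq nz_r dv_r)) //
      size_poly.
  apply: separable_sextic; first by rewrite -(dvdn_pcharf p_char).
  by rewrite (_ : _ + _ = (conductor m)%:R) -?(dvdn_pcharf p_char) //
    /conductor; ring.
(* The first factor would force [p = 3], which divides 6; the second would make [p ^ 2] divide
   [conductor n]. *)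
rewrite dvdzE /= Euclid_dvdM // =>
  /orP[/(conductor_dvd_deriv pr_p p_n) p3 | p_d].
  by rewrite p3 in p'6.
by rewrite Dd -mulnn dvdn_mul in p2'n.
Qed.

(** For [n = 9 m] with [m = N!], the conductor is [9 k] with [k] congruent to 1 modulo [m]; hence
    every prime factor of [k] exceeds [N]. *)
Lemma exists_ramified_prime (N : nat) : (2 < N)%N ->
  exists np : nat * nat, [&& prime np.2, (N < np.2)%N,
    (np.2 %| conductor np.1)%N & ~~ (np.2 ^ 2 %| conductor np.1)%N].
Proof.
move=> N_gt2; pose m := N`!; pose k := (9 * m ^ 2 + 3 * m).+1.
have m_gt0 : (0 < m)%N := fact_gt0 N.
have /pdivP[p pr_p p_k] : (1 < k)%N
  by rewrite /k ltnS addn_gt0 muln_gt0 expn_gt0 m_gt0.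
have p_D : (p %| conductor (9 * m))%N.
  by rewrite [conductor _](_ : _ = 9 * k)%N ?dvdn_mull // /conductor /k; ring.
have p_gtN : (N < p)%N.
  rewrite ltnNge; apply/negP => le_pN.
  have p_m : (p %| m)%N by rewrite dvdn_fact // prime_gt0.
  move: p_k; rewrite /k -addn1 dvdn_addr ?dvdn1.
    by move/eqP=> p1; rewrite p1 in pr_p.
  by rewrite dvdn_add ?dvdn_mull // dvdn_exp.
have [p2_D | p2'D] := boolP (p ^ 2 %| conductor (9 * m))%N; last first.
  by exists ((9 * m)%N, p); rewrite pr_p p_gtN p_D p2'D.
(* Shifting [n] by [p] adds [p (2 n + 3 + p)], which [p ^ 2] does not divide: [p] is not 3, so it
   does not divide [2 n + 3]. *)
have E : (conductor (9 * m + p)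
    = conductor (9 * m) + p * (2 * (9 * m) + 3 + p))%N.
  by rewrite /conductor; ring.
exists ((9 * m + p)%N, p); rewrite /= pr_p p_gtN E dvdn_add ?dvdn_mulr //=.
rewrite dvdn_addr // -mulnn dvdn_pmul2l ?prime_gt0 // dvdn_addl //.
apply/negP => /(conductor_dvd_deriv pr_p p_D) p3.
by rewrite p3 ltnNge N_gt2 in p_gtN.
Qed.

Theorem theorem4p18 :
  exists L : nat -> fieldExtType rat,
    (forall i j : nat, i <> j -> ~ field_isomorphic (L i) (L j)) /\
    (forall i : nat, \dim {:L i} = 6%N /\ delta (L i) = 1).
Proof.
have ex N : exists np : nat * nat, [&& prime np.2, (N.+3 < np.2)%N,
    (np.2 %| conductor np.1)%N & ~~ (np.2 ^ 2 %| conductor np.1)%N].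
  exact: exists_ramified_prime.
pose np N := xchoose (ex N).
(* [N_ j] sums the conductors of all earlier fields, so [p j] exceeds each of them; the offset 3
   also keeps [p j] from dividing 6. *)
pose N_ := fix N_ i := if i is j.+1 then (N_ j + conductor (np (N_ j)).1)%N
  else 0%N.
pose n i := (np (N_ i)).1; pose p i := (np (N_ i)).2.
have npP i : [&& prime (p i), ((N_ i).+3 < p i)%N,
    (p i %| conductor (n i))%N & ~~ (p i ^ 2 %| conductor (n i))%N].
  exact: xchooseP (ex (N_ i)).
have p'n i j : (i < j)%N -> ~~ (p j %| 6 * conductor (n i))%N.
  move=> lt_ij; have /and4P[pr_p lt_Np _ _] := npP j.
  have le_N : (conductor (n i) <= N_ j)%N.
    elim: j lt_ij {pr_p lt_Np} => // j IHj; rewrite ltnS leq_eqVlt.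
    case/predU1P=> [-> | /IHj/leq_trans-> //];
      [exact: leq_addl | exact: leq_addr].
  have lt_p k : (0 < k <= (N_ j).+3)%N -> ~~ (p j %| k)%N.
    by case/andP=> k_gt0 le_k; rewrite gtnNdvd // (leq_ltn_trans le_k).
  rewrite Euclid_dvdM // (Euclid_dvdM 2 3) // !negb_or !lt_p //.
  by rewrite !leqW // andbT /conductor addnS.
pose L i := projT1 (sextic_field_exists (n i)).
exists L; split=> [i j /eqP | i]; last first.
  rewrite /L; case: sextic_field_exists => K [z z0 genK] /=.
  by rewrite -genK (dim_sextic z0) (delta_sextic z0).
rewrite neq_ltn /L => /orP[] lt_ij [f [g fK gK]].
  have /and4P[pr_p _ pD p2D] := npP j; move: f g fK gK.
  case: (sextic_field_exists (n i)) => K [z z0 genK].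
  case: (sextic_field_exists (n j)) => K' [x x0 _] /= f g fK gK.
  (* [g] is only a function, so the root is verified after applying the injective morphism [f]. *)
  have /negP[] := sextic_no_root (g x) z0 genK pr_p (p'n _ _ lt_ij) pD p2D.
  by rewrite -(fmorph_root f) map_sextic rmorph_nat gK.
have /and4P[pr_p _ pD p2D] := npP i; move: f g fK gK.
case: (sextic_field_exists (n j)) => K [z z0 genK].
case: (sextic_field_exists (n i)) => K' [x x0 _] /= f g fK gK.
have /negP[] := sextic_no_root (f x) z0 genK pr_p (p'n _ _ lt_ij) pD p2D.
by rewrite -(rmorph_nat f) -map_sextic fmorph_root.
Qed.
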